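(* Let $$\lfloor z\rceil=\left\lfloor\tfrac{\operatorname{Re}z+\operatorname{Im}z+1}{2}\right\rfloor(1+i)+\left\lfloor\tfrac{\operatorname{Re}z-\operatorname{Im}z+1}{2}\right\rfloor(1-i)$$ be the nearest even choice function, whose fundamental set is $K=\{z:|\operatorname{Re}z|+|\operatorname{Im}z|\le1\}$. Define $$K_1=\{z\in K:|z-\tfrac{-1+i}{2}|\le\tfrac1{\sqrt2},\ |z-\tfrac{-1-i}{2}|\le\tfrac1{\sqrt2}\},$$ $$K_2=\{z\in K:|z-\tfrac{-1+i}{2}|\le\tfrac1{\sqrt2},\ |z-\tfrac{-1-i}{2}|\ge\tfrac1{\sqrt2},\ |z-\tfrac{1+i}{2}|\ge\tfrac1{\sqrt2}\},$$ $$K_j=-i\,K_{j-2}\quad\text{for }j=3,\dots,8.$$ Then the nearest even algorithm satisfies the finite building property with $\mathcal{P}=\{K_1,\dots,K_8\}$.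
   Context: Here $i=\sqrt{-1}$. The nearest even algorithm sends $z$ to the nearest Gaussian integer $x+yi$ with $x+y$ even (the formula fixes a convention for ties). For a choice function $\lfloor\cdot\rceil$ (a map to $\mathbb{Z}[i]$ with $|z-\lfloor z\rceil|\le1$) the fundamental set is $K=\overline{\{z-\lfloor z\rceil\}}$, and the Gauss map $G:K\to K$ is $G(z)=-1/z-\lfloor-1/z\rceil$ for $z\neq0$, $G(0)=0$. A finite partition of $K$ is a finite collection of closed sets with boundaries of zero Lebesgue measure and pairwise disjoint interiors whose union is $K$. A set is buildable from a collection $\mathcal{C}$ of closed sets (with null boundaries) if it is equal, up to measure zero, to some union of elements of $\mathcal{C}$. The algorithm satisfies the finite building property with $\mathcal{P}=\{K_1,\dots,K_N\}$ if $N>1$, $\mathcal{P}$ is a finite partition of $K$, and each $G(K_j)$ is buildable from $\mathcal{P}$. *)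

(* Defs.v *)
From HB Require Import structures.
From mathcomp Require Import all_boot all_order all_algebra.
From mathcomp Require Import all_classical all_reals all_analysis.
From mathcomp Require Export complex.
Set Implicit Arguments.
Unset Strict Implicit.
Unset Printing Implicit Defensive.
Import Order.TTheory GRing.Theory Num.Theory.
Import numFieldNormedType.Exports.
Local Open Scope classical_set_scope.
Local Open Scope ring_scope.
Local Open Scope complex_scope.

(* [complex] gives R[i] its field and order structure but no topology; it gets
   the one that every numFieldType carries, i.e. that of the norm `|z|. *)
HB.instance Definition _ (R : realType) := PseudoMetricNormedZmod.copy R[i] R[i]^o.

Section FiniteBuilding.
Variable R : realType.
Local Notation C := R[i].
Implicit Types (fl : C -> C) (A B : set C).

Definition gauss_int : set C :=
  [set z | complex.Re z \is a Num.int /\ complex.Im z \is a Num.int].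

Definition choice_function fl :=
  forall z : C, gauss_int (fl z) /\ `|z - fl z| <= 1.

Definition fundamental_set fl : set C :=
  closure (range (fun z => z - fl z)).

Definition gauss_map fl (z : C) : C :=
  if z == 0 then 0 else - 1 / z - fl (- 1 / z).

(* Two-dimensional Lebesgue measure, C being identified with R * R. *)
Definition plane_null A :=
  (@lebesgue_measure R \x @lebesgue_measure R)%E.-negligible
    [set p : R * R | A (p.1 +i* p.2)].

Definition ae_eq_set A B := plane_null ((A `\` B) `|` (B `\` A)).

Definition boundary A : set C := closure A `\` interior A.

Definition finite_partition (K : set C) (N : nat) (P : 'I_N -> set C) :=
  [/\ forall j, closed (P j),
      forall j, plane_null (boundary (P j)),
      forall j k, j != k -> interior (P j) `&` interior (P k) = set0 &
      \bigcup_j P j = K].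

Definition buildable (F : set (set C)) A :=
  exists2 D : set (set C), D `<=` F & ae_eq_set A (\bigcup_(B in D) B).

Definition finite_building_property fl (N : nat) (P : 'I_N -> set C) :=
  [/\ (1 < N)%N,
      finite_partition (fundamental_set fl) P &
      forall j, buildable (range P) (gauss_map fl @` P j)].

Definition nearest_even (z : C) : C :=
  (Num.floor ((complex.Re z + complex.Im z + 1) / 2))%:~R * (1 + 'i%C) +
  (Num.floor ((complex.Re z - complex.Im z + 1) / 2))%:~R * (1 - 'i%C).

Definition Kdiamond : set C := [set z | `|complex.Re z| + `|complex.Im z| <= 1].

(* `|z| lives in R[i], hence the embedding of the real radius; the order of
   R[i] is only used between real elements. *)
Definition disc_radius : C := (Num.sqrt 2)^-1%:C.

Definition K1 : set C :=
  [set z | [/\ Kdiamond z,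
      `|z - (- 1 + 'i%C) / 2| <= disc_radius &
      `|z - (- 1 - 'i%C) / 2| <= disc_radius]].

Definition K2 : set C :=
  [set z | [/\ Kdiamond z,
      `|z - (- 1 + 'i%C) / 2| <= disc_radius,
      `|z - (- 1 - 'i%C) / 2| >= disc_radius &
      `|z - (1 + 'i%C) / 2| >= disc_radius]].

(* [Kpiece n] is K_(n+1): indices start from 0. *)
Fixpoint Kpiece (n : nat) : set C :=
  match n with
  | 0 => K1
  | 1 => K2
  | n'.+2 => (fun z => - 'i%C * z) @` Kpiece n'
  end.

End FiniteBuilding.

Arguments nearest_even {R} z.
Arguments Kdiamond {R}.
Arguments Kpiece {R} n.

(* Main.v *)
Require Import Defs.
From mathcomp Require Import all_boot all_order all_algebra.
From mathcomp Require Import all_classical all_reals all_analysis.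
From mathcomp Require Import measurable_realfun ring lra.

(* With s = |z|^2, write each disc as s + a Re z + b Im z <= 0 with a, b = 1 or -1.
   Every K_j is the set of points of the diamond K with a prescribed sign for each
   of these four quadratics, which gives the partition: its pieces meet only on
   circles.  Under w = -1/z the disc bounded by the circle through 0 becomes a
   half-plane 1 - a Re w + b Im w <= 0, and -1/K_j contains the whole open diamond
   tile around an even Gaussian integer c_j, where c_1 = 2, c_2 = 2 + 2i and
   c_(j+2) = i c_j.  On that tile the nearest even integer is c_j, so G(K_j)
   contains the open diamond: G(K_j) = K up to measure zero for all j.  Null sets
   are handled by Fubini, since circles and non-vertical lines have finite vertical
   sections. *)

Set Implicit Arguments.
Unset Strict Implicit.
Unset Printing Implicit Defensive.
Import Order.TTheory GRing.Theory Num.Theory.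
Import numFieldNormedType.Exports.
Local Open Scope classical_set_scope.
Local Open Scope ring_scope.
Local Open Scope complex_scope.

(** * Circles and lines in the complex plane *)

Section ComplexTopology.
Variable R : realType.
Local Notation C := R[i].
Implicit Types (A B : set C) (z : C).

(** The square of half-side [e / 2] fits in the disc of radius [e], which fits in the square of
    half-side [e]. This reduces all topology on [R[i]] to real coordinates. *)
Lemma nbhs_complexP z A :
  nbhs z A <-> exists2 e : R, 0 < e &
    forall x y, `|x - complex.Re z| < e -> `|y - complex.Im z| < e -> A (x +i* y).
Proof.
case: z => a b /=; split.
  (* The radius is an element of [R[i]]; being positive there forces its imaginary part to be 0. *)
  case/nbhs_normP => -[e ie]; rewrite /= ltcE /= => /andP[/eqP -> e0] eA.
  exists (e / 2) => [|x y hx hy]; first by rewrite divr_gt0.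
  apply: eA; rewrite /= normc_def ltcR /=.
  rewrite -[ltRHS](ger0_norm (ltW e0)) -sqrtr_sqr ltr_sqrt ?exprn_gt0//.
  move: hx hy; rewrite !ltr_norml => /andP[? ?] /andP[? ?]; nra.
case=> e e0 eA; apply/nbhs_normP; exists e%:C => [|[x y] /=]; first by rewrite /= ltcR.
rewrite normc_def ltcR /= => h.
have bound t u : Num.sqrt (t ^+ 2 + u ^+ 2) < e -> `|t| < e.
  by apply: le_lt_trans; rewrite -sqrtr_sqr ler_wsqrtr// lerDl sqr_ge0.
by apply: eA; rewrite distrC; [exact: (bound _ _ h) | rewrite addrC in h; exact: (bound _ _ h)].
Qed.

Lemma continuous_Re : continuous (@complex.Re R : C -> R).
Proof.
move=> z; apply/(@cvgrPdist_lt _ _ _ (nbhs z)) => e e0.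
by apply/nbhs_complexP; exists e => //= x y hx _; rewrite distrC.
Qed.

Lemma continuous_Im : continuous (@complex.Im R : C -> R).
Proof.
move=> z; apply/(@cvgrPdist_lt _ _ _ (nbhs z)) => e e0.
by apply/nbhs_complexP; exists e => //= x y _ hy; rewrite distrC.
Qed.

(** * Null sets and null boundaries *)

Lemma plane_nullS A B : A `<=` B -> plane_null B -> plane_null A.
Proof. by move=> AB; apply: negligibleS => p; exact: AB. Qed.

Lemma plane_nullU A B : plane_null A -> plane_null B -> plane_null (A `|` B).
Proof. exact: negligibleU. Qed.

(** Circles ([k != 0]) and lines ([k = 0]) in one family, so that the discs and the sides of the
    diamond share the same lemmas. *)
Definition circline (k a b c : R) (z : C) : R :=
  k * (complex.Re z ^+ 2 + complex.Im z ^+ 2)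
  + a * complex.Re z + b * complex.Im z + c.

Lemma continuous_circline k a b c : continuous (circline k a b c).
Proof.
move=> z; have cRe := @continuous_Re z; have cIm := @continuous_Im z.
exact: (cvgD (cvgD (cvgD (cvgM (cvg_cst k) (cvgD (cvgM cRe cRe) (cvgM cIm cIm)))
  (cvgM (cvg_cst a) cRe)) (cvgM (cvg_cst b) cIm)) (cvg_cst c)).
Qed.

Lemma plane_null_circline0 k a b c : k != 0 \/ b != 0 ->
  plane_null [set z | circline k a b c z = 0].
Proof.
move=> kb; rewrite /plane_null /=.
set A := [set _ | _].
have mf : measurable_fun setT (fun p : R * R => circline k a b c (p.1 +i* p.2)).
  apply: measurable_funD => //; apply: measurable_funD; last first.
    by apply: measurable_funM => //; exact: measurable_snd.
  apply: measurable_funD; last by apply: measurable_funM => //; exact: measurable_fst.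
  apply: measurable_funM => //; apply: measurable_funD => /=.
    by apply: measurable_funX; exact: measurable_fst.
  by apply: measurable_funX; exact: measurable_snd.
have mA : measurable A.
  rewrite (_ : A = setT `&` (fun p : R * R => circline k a b c (p.1 +i* p.2)) @^-1` [set 0]).
    exact: mf.
  by rewrite setTI.
apply/negligibleP => //=; rewrite /product_measure1 /=.
apply: integral0_eq => x _ /=.
apply: countable_lebesgue_measure0; apply: finite_set_countable.
have [->|/set0P[y0]] := eqVneq (xsection A x) set0; first exact: finite_set0.
rewrite /xsection /= inE /A /circline /= => h0.
(* By Vieta, the second root of the quadratic in [y] is [- b / k - y0]. If [k = 0] the equation is
   linear and [y0] is its only root. *)
apply: (@sub_finite_set _ _ [set y0; - b / k - y0]); last exact: finite_set2.
move=> y; rewrite /xsection /= inE /A /circline /= => h.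
have : (y - y0) * (k * (y + y0) + b) = 0 by nra.
move/eqP; rewrite mulf_eq0 => /orP[/eqP e|/eqP e]; [left; lra|right => /=].
have k0 : k != 0.
  by case: kb => // b0; apply: contra_neq b0 => k0; move: e; rewrite k0 mul0r add0r.
apply: (mulfI k0); rewrite mulrBr mulrCA divff// mulr1; lra.
Qed.

Definition null_boundary_closed A := closed A /\ plane_null (boundary A).

Lemma null_boundary_closedI A B :
  null_boundary_closed A -> null_boundary_closed B -> null_boundary_closed (A `&` B).
Proof.
move=> [cA nA] [cB nB]; split; first exact: closedI.
apply: plane_nullS (plane_nullU nA nB) => z [/closureI[zA zB]].
rewrite interiorI => /not_andP[|] h; [left|right]; by split.
Qed.

(** By continuity the set where the function is positive is open, so the boundary lies in its zero
    set. *)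
Lemma null_boundary_closed_circline k a b c : k != 0 \/ b != 0 ->
  null_boundary_closed [set z | 0 <= circline k a b c z].
Proof.
move=> kb; have cf := @continuous_circline k a b c.
have clA : closed [set z | 0 <= circline k a b c z].
  exact: ((continuous_closedP (circline k a b c)).1 cf _ (@closed_ge R 0)).
split=> //; apply: plane_nullS (plane_null_circline0 a c kb) => z [] /=.
move/clA => /=; rewrite le_eqVlt => /predU1P[<-//|f0] [].
apply: (@filterS _ (nbhs z) _ (circline k a b c @^-1` [set x | 0 < x])) => [w /ltW //|].
by apply: cf; apply: open_nbhs_nbhs; split => //; exact: open_gt.
Qed.

Lemma circline_eq0_interior k a b c z : k != 0 ->
  ~ nbhs z [set w | circline k a b c w = 0].
Proof.
move=> k0 /nbhs_complexP[e e0]; case: z => x y /= h.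
have point t : `|t| < e -> circline k a b c (x +i* (y + t)) = 0.
  by move=> te; apply: h; rewrite ?subrr ?normr0// addrAC subrr add0r.
have h0 := point 0; rewrite normr0 in h0; have {}h0 := h0 e0.
have h1 := point (e / 2); have h2 := point (- (e / 2)).
rewrite normrN in h2; rewrite !gtr0_norm ?divr_gt0// in h1 h2.
have he : e / 2 < e by lra.
have {}h1 := h1 he; have {}h2 := h2 he.
rewrite /circline /= in h0 h1 h2.
(* The second difference in [y] with step [e / 2] equals [k * e ^+ 2 / 2], and all three values
   vanish. *)
have : k * e ^+ 2 = 0 by lra.
by move/eqP; rewrite mulf_eq0 (negbTE k0) sqrf_eq0 gt_eqF.
Qed.

End ComplexTopology.

(** * The pieces as sign patterns *)

Section Pieces.
Variable R : realType.
Local Notation C := R[i].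
Implicit Types (a b : R) (z : C) (s : bool).

(* [true] is the closed disc of radius 1/sqrt 2 centred at [- (a + b i) / 2],
   [false] the closure of its complement. *)
Definition disc_side s a b : set C :=
  [set z | 0 <= circline ((-1) ^+ s) ((-1) ^+ s * a) ((-1) ^+ s * b) 0 z].

(** The discs are listed clockwise by centre, starting at (-1-i)/2, so that multiplication by -i
    shifts the four signs by one place. *)
Definition piece s1 s2 s3 s4 : set C :=
  Kdiamond `&` disc_side s1 1 1 `&` disc_side s2 1 (-1)
  `&` disc_side s3 (-1) (-1) `&` disc_side s4 (-1) 1.

Lemma disc_sideE s a b x y : disc_side s a b (x +i* y) =
  is_true (if s then x ^+ 2 + y ^+ 2 + a * x + b * y <= 0
           else 0 <= x ^+ 2 + y ^+ 2 + a * x + b * y).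
Proof.
rewrite /disc_side /circline /=.
by congr is_true; case: s; rewrite ?expr1 ?expr0; apply/idP/idP; lra.
Qed.

Lemma Kdiamond_halfplanes :
  @Kdiamond R = [set z | 0 <= circline 0 1 1 1 z] `&` [set z | 0 <= circline 0 1 (-1) 1 z]
    `&` [set z | 0 <= circline 0 (-1) 1 1 z] `&` [set z | 0 <= circline 0 (-1) (-1) 1 z].
Proof.
apply/seteqP; rewrite /Kdiamond /circline; split=> -[x y] /=.
  have := ler_norm x; have := ler_norm y; have := lerNnormlW (lexx `|x|).
  have := lerNnormlW (lexx `|y|) => *; repeat split; lra.
by case: (ger0P x); case: (ger0P y) => _ _ [[[? ?] ?] ?]; lra.
Qed.

Lemma null_boundary_closed_Kdiamond : null_boundary_closed (@Kdiamond R).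
Proof.
rewrite Kdiamond_halfplanes; do !apply: null_boundary_closedI;
  apply: null_boundary_closed_circline; right;
  by rewrite ?oppr_eq0 oner_eq0.
Qed.

Lemma null_boundary_closed_piece s1 s2 s3 s4 : null_boundary_closed (piece s1 s2 s3 s4).
Proof.
have side s a b : null_boundary_closed (disc_side s a b).
  by apply: null_boundary_closed_circline; left; rewrite signr_eq0.
do !apply: null_boundary_closedI => //; exact: null_boundary_closed_Kdiamond.
Qed.

Lemma interior_disc_sideI a b :
  interior (disc_side false a b) `&` interior (disc_side true a b) = set0.
Proof.
rewrite -interiorI; apply/seteqP; split=> // z; rewrite /interior /= => h.
apply: (@circline_eq0_interior R 1 a b 0 z (oner_neq0 _)).
apply: filterS h => -[x y]; rewrite /setI /= !disc_sideE /circline /= => -[? ?].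
apply/eqP; rewrite eq_le; apply/andP; split; lra.
Qed.

Lemma interior_piece s1 s2 s3 s4 :
  interior (piece s1 s2 s3 s4) =
  interior Kdiamond `&` interior (disc_side s1 1 1) `&` interior (disc_side s2 1 (-1))
  `&` interior (disc_side s3 (-1) (-1)) `&` interior (disc_side s4 (-1) 1).
Proof. by rewrite /piece !interiorI. Qed.

(** A common interior point would be interior to both sides of some disc, hence have a neighbourhood
    inside a circle. *)
Lemma interior_pieceI s1 s2 s3 s4 t1 t2 t3 t4 :
  (s1, s2, s3, s4) != (t1, t2, t3, t4) ->
  interior (piece s1 s2 s3 s4) `&` interior (piece t1 t2 t3 t4) = set0.
Proof.
move=> neq; rewrite !interior_piece; apply/seteqP; split=> // z.
case=> -[[[[_ a1] a2] a3] a4] [[[[_ b1] b2] b3] b4].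
have eq_side a b s t : (interior (disc_side s a b)) z ->
    (interior (disc_side t a b)) z -> s = t.
  have := interior_disc_sideI a b => /seteqP[/(_ z) h _].
  by case: s; case: t => // ? ?; case: h.
by move: neq; rewrite (eq_side _ _ _ _ a1 b1) (eq_side _ _ _ _ a2 b2)
  (eq_side _ _ _ _ a3 b3) (eq_side _ _ _ _ a4 b4) eqxx.
Qed.

(** * The discs as real quadratics *)

Lemma half_complexE (a b : R) : (a +i* b) / 2 = (a / 2) +i* (b / 2) :> C.
Proof.
have two0 : 2 != 0 :> C by rewrite pnatr_eq0.
apply: (mulIf two0); rewrite divfK// mulr_natr mulr2n /=.
by congr (_ +i* _); lra.
Qed.

Lemma norm_le_disc_radius (x y a b : R) : a ^+ 2 = 1 -> b ^+ 2 = 1 ->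
  (`|x +i* y - (- a / 2) +i* (- b / 2)| <= disc_radius R)
    = (x ^+ 2 + y ^+ 2 + a * x + b * y <= 0).
Proof.
move=> a1 b1; rewrite normc_def /disc_radius lecR /= -sqrtrV// ler_sqrt ?invr_ge0//.
by apply/idP/idP; nra.
Qed.

Lemma norm_ge_disc_radius (x y a b : R) : a ^+ 2 = 1 -> b ^+ 2 = 1 ->
  (disc_radius R <= `|x +i* y - (- a / 2) +i* (- b / 2)|)
    = (0 <= x ^+ 2 + y ^+ 2 + a * x + b * y).
Proof.
move=> a1 b1; rewrite normc_def /disc_radius lecR /= -sqrtrV// ler_sqrt; last first.
  by rewrite addr_ge0// sqr_ge0.
by apply/idP/idP; nra.
Qed.

Lemma centerNP : (- 1 + 'i) / 2 = (- 1 / 2) +i* (- (- 1) / 2) :> C.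
Proof. by rewrite opprK -half_complexE; congr (_ / _); congr (_ +i* _); lra. Qed.

Lemma centerNN : (- 1 - 'i) / 2 = (- 1 / 2) +i* (- 1 / 2) :> C.
Proof. by rewrite -half_complexE; congr (_ / _); congr (_ +i* _); lra. Qed.

Lemma centerPP : (1 + 'i) / 2 = (- (- 1) / 2) +i* (- (- 1) / 2) :> C.
Proof. by rewrite opprK -half_complexE; congr (_ / _); congr (_ +i* _); lra. Qed.

(** The quadratics of two opposite discs add up to 2|z|^2 >= 0, so a point of one disc lies on the
    outer side of the other. This supplies the two signs that [K1] does not mention, and likewise
    the fourth sign of [K2]. *)
Lemma K1_piece : @K1 R = piece true true false false.
Proof.
have N1 : (-1 : R) ^+ 2 = 1 by rewrite sqrrN expr1n.
have P1 : (1 : R) ^+ 2 = 1 by rewrite expr1n.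
apply/seteqP; rewrite /K1 /piece; split => -[x y] /=; rewrite !disc_sideE /=
  centerNP centerNN !norm_le_disc_radius//.
  by move=> [? ? ?]; repeat split => //; nra.
by move=> [[[[? ?] ?] ?] ?].
Qed.

Lemma K2_piece : @K2 R = piece false true false false.
Proof.
have N1 : (-1 : R) ^+ 2 = 1 by rewrite sqrrN expr1n.
have P1 : (1 : R) ^+ 2 = 1 by rewrite expr1n.
apply/seteqP; rewrite /K2 /piece; split => -[x y] /=; rewrite !disc_sideE /=
  centerNP centerNN centerPP norm_le_disc_radius// !norm_ge_disc_radius//.
  by move=> [? ? ? ?]; repeat split => //; nra.
by move=> [[[[? ?] ?] ?] ?].
Qed.

Lemma mulNi (x y : R) : - 'i * (x +i* y) = y +i* (- x) :> C.
Proof. by congr (_ +i* _); rewrite /=; lra. Qed.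

Lemma piece_rot s1 s2 s3 s4 :
  (fun z : C => - 'i * z) @` piece s1 s2 s3 s4 = piece s4 s1 s2 s3.
Proof.
apply/seteqP; split => [_ [[x y] + <-]|[x y]]; rewrite ?mulNi /piece /setI /= !disc_sideE.
  rewrite /Kdiamond /= normrN => -[[[[h0 h1] h2] h3] h4].
  split; [split; [split; [split|]|]|]; first lra.
  - by case: s4 h4; lra.
  - by case: s1 h1; lra.
  - by case: s2 h2; lra.
  - by case: s3 h3; lra.
rewrite /Kdiamond /= => -[[[[h0 h4] h1] h2] h3].
(* The preimage under multiplication by -i is i(x + iy). *)
exists ((- y) +i* x); last by rewrite mulNi opprK.
rewrite !disc_sideE /= normrN.
split; [split; [split; [split|]|]|]; first lra.
- by case: s1 h1; lra.
- by case: s2 h2; lra.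
- by case: s3 h3; lra.
- by case: s4 h4; lra.
Qed.

(* Multiplication by -i permutes the four discs cyclically, so each piece is
   encoded by which of the discs contain it. *)
Definition signs_rot (p : bool * bool * bool * bool) :=
  let: (s1, s2, s3, s4) := p in (s4, s1, s2, s3).

Fixpoint signs n : bool * bool * bool * bool :=
  match n with
  | 0 => (true, true, false, false)
  | 1 => (false, true, false, false)
  | n'.+2 => signs_rot (signs n')
  end.

Lemma Kpiece_piece n :
  Kpiece n = let: (s1, s2, s3, s4) := signs n in piece s1 s2 s3 s4 :> set C.
Proof.
elim/ltn_ind: n => -[_|[_|m IH]] /=; [exact: K1_piece|exact: K2_piece|].
by rewrite IH//; case: (signs m) => [[[s1 s2] s3] s4]; rewrite piece_rot.
Qed.

Lemma signs_inj m n : (m < 8)%N -> (n < 8)%N -> signs m = signs n -> m = n.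
Proof.
by case: m => [|[|[|[|[|[|[|[|m]]]]]]]] //; case: n => [|[|[|[|[|[|[|[|n]]]]]]]].
Qed.

Lemma Kpiece_cover : \bigcup_(j : 'I_8) Kpiece j = @Kdiamond R.
Proof.
apply/seteqP; split => [z [j _]|[x y] Kz].
  by rewrite Kpiece_piece; case: (signs j) => [[[s1 s2] s3] s4] [[[[]]]].
suff [n n8 nz] : exists2 n, (n < 8)%N & Kpiece n (x +i* y) by exists (Ordinal n8).
have s0 : 0 <= x ^+ 2 + y ^+ 2 by rewrite addr_ge0// sqr_ge0.
have x2 : x ^+ 2 <= `|x|.
  rewrite -real_normK ?num_real// expr2 ler_piMr//.
  by move: Kz; rewrite /Kdiamond /=; have := normr_ge0 y; lra.
have y2 : y ^+ 2 <= `|y|.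
  rewrite -real_normK ?num_real// expr2 ler_piMr//.
  by move: Kz; rewrite /Kdiamond /=; have := normr_ge0 x; lra.
have in_piece n s1 s2 s3 s4 : signs n = (s1, s2, s3, s4) ->
    [/\ disc_side s1 1 1 (x +i* y), disc_side s2 1 (-1) (x +i* y),
       disc_side s3 (-1) (-1) (x +i* y) & disc_side s4 (-1) 1 (x +i* y)] ->
    Kpiece n (x +i* y).
  by rewrite Kpiece_piece => -> [].
(* Of the sixteen sign patterns, eight are those of the pieces. Those with two opposite discs force
   z = 0 or are contradictory. Lying strictly outside all four discs means |x| + |y| < x^2 + y^2,
   against [x2] and [y2]. *)
case: (leP (x ^+ 2 + y ^+ 2 + x + y) 0) => h1;
  case: (leP (x ^+ 2 + y ^+ 2 + x - y) 0) => h2;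
  case: (leP (x ^+ 2 + y ^+ 2 - x - y) 0) => h3;
  case: (leP (x ^+ 2 + y ^+ 2 - x + y) 0) => h4;
  [exists 0|exists 0|exists 0|exists 0|exists 6|exists 7|exists 6|exists 7
  |exists 2|exists 2|exists 1|exists 1|exists 4|exists 3|exists 5|exfalso] => //;
  try by apply: in_piece; [reflexivity|split; rewrite disc_sideE; lra].
move: x2 y2; case: (ger0P x); case: (ger0P y) => *; lra.
Qed.

End Pieces.

(** * The Gauss map *)

Section GaussMap.
Variable R : realType.
Local Notation C := R[i].
Implicit Types (z w t : C).

Definition open_diamond : set C :=
  [set z | `|complex.Re z| + `|complex.Im z| < 1].

Lemma nearest_evenE (x y : R) :
  let p := (Num.floor ((x + y + 1) / 2))%:~R in
  let q := (Num.floor ((x - y + 1) / 2))%:~R in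
  nearest_even (x +i* y) = (p + q) +i* (p - q).
Proof.
rewrite /nearest_even /=.
rewrite -!(rmorph_int (real_complex R)).
by congr (_ +i* _); rewrite /=; lra.
Qed.

(** Sum and difference of the coordinates separate the two floors: their arguments are m + (1 + x +
    y)/2 and n + (1 + x - y)/2, with |x + y| and |x - y| below 1. *)
Lemma nearest_even_center (m n : int) (x y : R) : `|x| + `|y| < 1 ->
  nearest_even ((m%:~R + n%:~R + x) +i* (m%:~R - n%:~R + y)) =
  (m%:~R + n%:~R) +i* (m%:~R - n%:~R).
Proof.
move=> xy; have := ler_norm x; have := ler_norm y.
have := lerNnormlW (lexx `|x|); have := lerNnormlW (lexx `|y|) => *.
rewrite nearest_evenE; set p := Num.floor _; set q := Num.floor _.
have -> : p = m by apply: floor_def; rewrite intrD; lra.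
by have -> : q = n by apply: floor_def; rewrite intrD; lra.
Qed.

Lemma subr_nearest_even_Kdiamond z : Kdiamond (z - nearest_even z).
Proof.
case: z => x y; rewrite nearest_evenE /Kdiamond /=.
set p := (X in X%:~R + _); set q := (X in _ + X%:~R).
have /andP[] := floor_itv ((x + y + 1) / 2); rewrite -/p.
have /andP[] := floor_itv ((x - y + 1) / 2); rewrite -/q !intrD => *.
by case: ger0P => _; case: ger0P => _; lra.
Qed.

Lemma choice_function_nearest_even : choice_function (@nearest_even R).
Proof.
move=> z; split.
  case: z => x y; rewrite nearest_evenE; split => /=.
    by rewrite rpredD// intr_int.
  by rewrite rpredB// intr_int.
have := subr_nearest_even_Kdiamond z; case: (z - nearest_even z) => x y.
rewrite /Kdiamond /= => xy; rewrite normc_def (_ : 1 = 1%:C)// lecR /=.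
rewrite -sqrtr1 ler_sqrt// -(real_normK (num_real x)) -(real_normK (num_real y)).
have := normr_ge0 x; have := normr_ge0 y; nra.
Qed.

(** The diamond is closed and contains all remainders. Conversely, for z in the diamond, (1 - d)z
    lies in the open tile around 0, so it is its own remainder, and it tends to z as d tends to
    0. *)
Lemma fundamental_set_nearest_even : fundamental_set (@nearest_even R) = Kdiamond.
Proof.
apply/seteqP; split.
  have [cK _] := null_boundary_closed_Kdiamond R.
  rewrite [X in _ `<=` X](closure_id _).1//; apply: closure_subset.
  by move=> _ [z _ <-]; exact: subr_nearest_even_Kdiamond.
move=> [x y] Kz A /nbhs_complexP[e e0 /= eA]; rewrite /Kdiamond /= in Kz.
have [d [d0 d1 de]] : exists d : R, [/\ 0 < d, d < 1 & d < e].
  exists (Num.min (e / 2) (1 / 2)); split.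
  - by rewrite lt_min !divr_gt0.
  - by rewrite gt_min; apply/orP; right; lra.
  - by rewrite gt_min; apply/orP; left; lra.
have shrink (t : R) : `|t| <= 1 -> `|(1 - d) * t - t| < e.
  move=> t1; rewrite mulrBl mul1r addrAC subrr add0r normrN normrM gtr0_norm//.
  by rewrite (le_lt_trans _ de)// ler_piMr// ltW.
have x0 := normr_ge0 x; have y0 := normr_ge0 y.
exists (((1 - d) * x) +i* ((1 - d) * y)); split; last by apply: eA; apply: shrink; lra.
exists (((1 - d) * x) +i* ((1 - d) * y)) => //.
have := @nearest_even_center 0 0 ((1 - d) * x) ((1 - d) * y).
rewrite !mulr0z subr0 !add0r => ->; last first.
  by rewrite !normrM [`|1 - d|]ger0_norm; [nra|lra].
by congr (_ +i* _); rewrite /= subr0.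
Qed.

Lemma gauss_map_subset (A : set C) : gauss_map (@nearest_even R) @` A `<=` Kdiamond.
Proof.
move=> _ [z _ <-]; rewrite /gauss_map; case: ifP => _.
  by rewrite /Kdiamond /= normr0 addr0 ler01.
exact: subr_nearest_even_Kdiamond.
Qed.

(** * Inversion of the discs and of the diamond *)

Lemma opp_inv_complexE (x y : R) :
  - 1 / (x +i* y) = (- x / (x ^+ 2 + y ^+ 2)) +i* (y / (x ^+ 2 + y ^+ 2)).
Proof. by congr (_ +i* _); rewrite /=; lra. Qed.

Lemma sqr_Re_Im_gt0 (x y : R) : x +i* y != 0 :> C -> 0 < x ^+ 2 + y ^+ 2.
Proof.
move=> w0; rewrite lt_neqAle addr_ge0 ?sqr_ge0// andbT eq_sym paddr_eq0 ?sqr_ge0//.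
by rewrite !sqrf_eq0; move: w0; rewrite eq_complex.
Qed.

(** At -1/w the quadratic takes the value (1 - ax + by)/|w|^2, which has the sign of its
    numerator. *)
Lemma disc_side_opp_inv s (a b x y : R) : x +i* y != 0 ->
  (if s then 1 - a * x + b * y <= 0 else 0 <= 1 - a * x + b * y) ->
  disc_side s a b (- 1 / (x +i* y)).
Proof.
move=> w0; rewrite opp_inv_complexE disc_sideE.
set n := x ^+ 2 + y ^+ 2.
have n0 : 0 < n by exact: sqr_Re_Im_gt0.
have -> : (- x / n) ^+ 2 + (y / n) ^+ 2 + a * (- x / n) + b * (y / n)
    = (1 - a * x + b * y) / n.
  have nE : (x / n) ^+ 2 + (y / n) ^+ 2 = n^-1.
    by rewrite !expr_div_n -mulrDl -/n expr2 invfM mulrA divff ?gt_eqF// mul1r.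
  rewrite mulNr sqrrN nE; lra.
by case: s; rewrite ?pmulr_lle0 ?pmulr_lge0 ?invr_gt0.
Qed.

Lemma Kdiamond_opp_inv (x y : R) : x +i* y != 0 ->
  `|x| + `|y| <= x ^+ 2 + y ^+ 2 -> Kdiamond (- 1 / (x +i* y)).
Proof.
move=> w0; rewrite opp_inv_complexE /Kdiamond /=.
set n := x ^+ 2 + y ^+ 2.
have n0 : 0 < n by exact: sqr_Re_Im_gt0.
by rewrite !normrM normrN normfV (gtr0_norm n0) -mulrDl ler_pdivrMr// mul1r.
Qed.

(** Since -1/z is an involution, t is the image of -1/(c + t), where c = p + qi = m(1+i) + n(1-i) is
    the centre of the tile. *)
Lemma open_diamond_gauss_map (A : set C) (m n : int) (p q : R) :
  m%:~R + n%:~R = p -> m%:~R - n%:~R = q ->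
  (forall x y, `|x| + `|y| < 1 ->
     (p + x) +i* (q + y) != 0 /\ A (- 1 / ((p + x) +i* (q + y)))) ->
  open_diamond `<=` gauss_map (@nearest_even R) @` A.
Proof.
move=> <- <- h [x y] xy; have [w0 Aw] := h _ _ xy.
exists (- 1 / ((m%:~R + n%:~R + x) +i* (m%:~R - n%:~R + y))) => //.
rewrite /gauss_map mulf_eq0 invr_eq0 (negbTE w0) oppr_eq0 oner_eq0 /=.
have -> (w : C) : - 1 / (- 1 / w) = w by rewrite !mulN1r invrN invrK opprK.
by rewrite nearest_even_center//; congr (_ +i* _); rewrite /=; lra.
Qed.

(* The tile centres 2, 2 + 2i and their rotations have [- 1 / (centre + t)] in the
   corresponding piece for every [t] in the open diamond. *)
Lemma open_diamond_gauss_map_Kpiece j : (j < 8)%N ->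
  open_diamond `<=` gauss_map (@nearest_even R) @` Kpiece j.
Proof.
have in_piece (u v : R) s1 s2 s3 s4 : 0 < `|u| + `|v| <= u ^+ 2 + v ^+ 2 ->
    [/\ if s1 then 1 - u + v <= 0 else 0 <= 1 - u + v,
       if s2 then 1 - u - v <= 0 else 0 <= 1 - u - v,
       if s3 then 1 + u - v <= 0 else 0 <= 1 + u - v &
       if s4 then 1 + u + v <= 0 else 0 <= 1 + u + v] ->
    u +i* v != 0 /\ piece s1 s2 s3 s4 (- 1 / (u +i* v)).
  move=> /andP[uv0 uvn] [h1 h2 h3 h4].
  have w0 : u +i* v != 0.
    apply: contraTneq uv0 => -[-> ->]; by rewrite normr0 addr0 ltxx.
  split => //; split; [split; [split; [split|]|]|].
  - exact: Kdiamond_opp_inv.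
  - by apply: disc_side_opp_inv => //; case: s1 h1; lra.
  - by apply: disc_side_opp_inv => //; case: s2 h2; lra.
  - by apply: disc_side_opp_inv => //; case: s3 h3; lra.
  - by apply: disc_side_opp_inv => //; case: s4 h4; lra.
(* Three criteria for -1/w to lie in the diamond: [large] serves the centres with both coordinates 2
   or -2, [right] those on the real axis, [up] those on the imaginary axis. *)
have large (u v : R) : 1 <= `|u| -> 1 <= `|v| ->
    0 < `|u| + `|v| <= u ^+ 2 + v ^+ 2.
  rewrite -(real_normK (num_real u)) -(real_normK (num_real v)) => *.
  by apply/andP; split; nra.
have right (u v : R) : 1 + `|v| <= `|u| -> 0 < `|u| + `|v| <= u ^+ 2 + v ^+ 2.
  have := normr_ge0 v.
  rewrite -(real_normK (num_real u)) -(real_normK (num_real v)) => *.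
  by apply/andP; split; nra.
have up (u v : R) : 1 + `|u| <= `|v| -> 0 < `|u| + `|v| <= u ^+ 2 + v ^+ 2.
  by move=> /right; rewrite addrC [v ^+ 2 + _]addrC.
have bounds (x y : R) : `|x| + `|y| < 1 ->
    [/\ x + y < 1, x - y < 1, - x + y < 1 & - x - y < 1].
  by case: (ger0P x); case: (ger0P y) => *; split; lra.
case: j => [|[|[|[|[|[|[|[|//]]]]]]]] _.
(* The centres run through 2, 2+2i, 2i, -2+2i, -2, -2-2i, -2i, 2-2i: replacing z by -iz multiplies
   -1/z by i. *)
- apply: (@open_diamond_gauss_map _ 1 1 2 0); [lra|lra|].
  move=> x y /bounds[? ? ? ?]; rewrite Kpiece_piece; apply: in_piece; last by split; lra.
  by apply: right; case: (ger0P (2 + x)); case: (ger0P (0 + y)) => *; lra.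
- apply: (@open_diamond_gauss_map _ 2 0 2 2); [lra|lra|].
  move=> x y /bounds[? ? ? ?]; rewrite Kpiece_piece; apply: in_piece; last by split; lra.
  by apply: large; [case: (ger0P (2 + x)) | case: (ger0P (2 + y))] => *; lra.
- apply: (@open_diamond_gauss_map _ 1 (-1) 0 2); [lra|lra|].
  move=> x y /bounds[? ? ? ?]; rewrite Kpiece_piece; apply: in_piece; last by split; lra.
  by apply: up; case: (ger0P (0 + x)); case: (ger0P (2 + y)) => *; lra.
- apply: (@open_diamond_gauss_map _ 0 (-2) (-2) 2); [lra|lra|].
  move=> x y /bounds[? ? ? ?]; rewrite Kpiece_piece; apply: in_piece; last by split; lra.
  by apply: large; [case: (ger0P ((-2) + x)) | case: (ger0P (2 + y))] => *; lra.
- apply: (@open_diamond_gauss_map _ (-1) (-1) (-2) 0); [lra|lra|].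
  move=> x y /bounds[? ? ? ?]; rewrite Kpiece_piece; apply: in_piece; last by split; lra.
  by apply: right; case: (ger0P ((-2) + x)); case: (ger0P (0 + y)) => *; lra.
- apply: (@open_diamond_gauss_map _ (-2) 0 (-2) (-2)); [lra|lra|].
  move=> x y /bounds[? ? ? ?]; rewrite Kpiece_piece; apply: in_piece; last by split; lra.
  by apply: large; [case: (ger0P ((-2) + x)) | case: (ger0P ((-2) + y))] => *; lra.
- apply: (@open_diamond_gauss_map _ (-1) 1 0 (-2)); [lra|lra|].
  move=> x y /bounds[? ? ? ?]; rewrite Kpiece_piece; apply: in_piece; last by split; lra.
  by apply: up; case: (ger0P (0 + x)); case: (ger0P ((-2) + y)) => *; lra.
- apply: (@open_diamond_gauss_map _ 0 2 2 (-2)); [lra|lra|].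
  move=> x y /bounds[? ? ? ?]; rewrite Kpiece_piece; apply: in_piece; last by split; lra.
  by apply: large; [case: (ger0P (2 + x)) | case: (ger0P ((-2) + y))] => *; lra.
Qed.

(** The points with |x| + |y| = 1 lie on four lines, none of them vertical. *)
Lemma plane_null_Kdiamond_frontier : plane_null (@Kdiamond R `\` open_diamond).
Proof.
have null a b : b != 0 -> plane_null [set z | circline 0 a b 1 z = 0 :> R].
  by move=> b0; apply: plane_null_circline0; right.
have n1 := oner_neq0 R; have nN1 : -1 != 0 :> R by rewrite oppr_eq0.
apply: plane_nullS (plane_nullU (plane_nullU (null 1 1 n1) (null 1 (-1) nN1))
  (plane_nullU (null (-1) 1 n1) (null (-1) (-1) nN1))).
move=> -[x y] []; rewrite /Kdiamond /open_diamond /setU /circline /= => K1 /negP.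
rewrite -leNgt => K2; move: K1 K2; case: (ger0P x); case: (ger0P y) => *.
- by right; right; lra.
- by right; left; lra.
- by left; right; lra.
- by left; left; lra.
Qed.

Lemma buildable_gauss_map_Kpiece (j : 'I_8) :
  buildable (range (fun k : 'I_8 => Kpiece k)) (gauss_map (@nearest_even R) @` Kpiece j).
Proof.
(* All eight pieces are taken, since each image fills the diamond up to its frontier. *)
exists (range (fun k : 'I_8 => Kpiece k)) => //.
rewrite bigcup_image Kpiece_cover.
apply: plane_nullS plane_null_Kdiamond_frontier => z [[Gz nKz]|[Kz nGz]].
  by case: nKz; exact: gauss_map_subset Gz.
by split=> // Oz; apply: nGz; exact: open_diamond_gauss_map_Kpiece Oz.
Qed.

End GaussMap.

Theorem proposition4p2 (R : realType) :
  [/\ choice_function (@nearest_even R),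
      fundamental_set (@nearest_even R) = Kdiamond &
      finite_building_property (@nearest_even R)
        (fun j : 'I_8 => Kpiece (nat_of_ord j))].
Proof.
split; [exact: choice_function_nearest_even|exact: fundamental_set_nearest_even|].
have null_boundary_closed_Kpiece n : null_boundary_closed (@Kpiece R n).
  rewrite Kpiece_piece; case: (signs n) => [[[s1 s2] s3] s4].
  exact: null_boundary_closed_piece.
split=> //; last exact: buildable_gauss_map_Kpiece.
rewrite fundamental_set_nearest_even; split.
- by move=> j; have [] := null_boundary_closed_Kpiece j.
- by move=> j; have [] := null_boundary_closed_Kpiece j.
- move=> j k; rewrite -val_eqE => jk; rewrite !Kpiece_piece.
  (* Distinct indices have distinct sign patterns, which makes the interiors disjoint. *)
  have := contra_neq (@signs_inj _ _ (ltn_ord j) (ltn_ord k)) jk.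
  case: (signs j) => [[[s1 s2] s3] s4]; case: (signs k) => [[[t1 t2] t3] t4].
  exact: interior_pieceI.
- exact: Kpiece_cover.
Qed.
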